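(* Let $p$ be an odd prime and let $G$ be a finite $\mathrm{Qd}(p)$-free group. Suppose that $P \trianglelefteq G$ is a $p$-group and that $x \in G$ satisfies $[P,x,x]=1$. Then $x$ acts trivially on every $G$-chief factor of $P$, and $x \in O_p(G \bmod C_G(P))$.
   Context: All groups are finite. $\mathrm{Qd}(p)$ denotes the semidirect product $\mathbb{F}_p^2 \rtimes SL_2(p)$ of $SL_2(p)$ with its natural module. A group $G$ is $\mathrm{Qd}(p)$-free if there do not exist subgroups $K \trianglelefteq H \leq G$ with $H/K \cong \mathrm{Qd}(p)$. For a subgroup $P$ normalized by $x$, $[P,x]$ is the subgroup generated by the commutators $[g,x]$, $g \in P$, and $[P,x,x] = [[P,x],x]$. A $G$-chief factor of $P$ is a quotient $V/U$ where $U < V \leq P$, both $U$ and $V$ are normal in $G$, and no normal subgroup of $G$ lies strictly between $U$ and $V$; $G$ acts on it by conjugation. $O_p(X)$ is the largest normal $p$-subgroup of $X$, and for $N \trianglelefteq G$, $O_p(G \bmod N)$ denotes the full inverse image in $G$ of $O_p(G/N)$. *)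

(* Defs.v *)
From mathcomp Require Import all_boot all_order all_fingroup all_algebra.
From mathcomp Require Import all_solvable all_field all_character.

Set Implicit Arguments.
Unset Strict Implicit.
Unset Printing Implicit Defensive.

Import GRing.Theory.
Local Open Scope group_scope.

Definition SL2 (p : nat) : {set {'GL_2(p)}} :=
  [set u : {'GL_2(p)} | (\det (GLval u) == 1)%R].

Fact SL2_group_set (p : nat) : group_set (SL2 p).
Proof.
apply/group_setP; split=> [|u v]; first by rewrite inE GL_1E det1.
by rewrite !inE GL_ME det_mulmx => /eqP-> /eqP->; rewrite mulr1.
Qed.
Canonical SL2_group (p : nat) : {group {'GL_2(p)}} := Group (SL2_group_set p).

Definition SL2_natural (p : nat) : mx_representation 'F_p (SL2 p) 2 :=
  subg_repr (GLrepr 'F_p 1) (subsetT (SL2 p)).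

(* MathComp actions are right actions, so SL_2(p) acts on row vectors by      *)
(* u |-> u *m g; passing to columns only twists by inverse transpose, which   *)
(* does not change the isomorphism type of the semidirect product.            *)
Definition Qd (p : nat) : finGroupType :=
  sdprod_by ('MR (SL2_natural p))%gact.

Definition Qd_free (p : nat) (gT : finGroupType) (G : {set gT}) : Prop :=
  forall H K : {group gT},
    H \subset G -> K <| H -> ~ (H / K \isog [set: Qd p]).

(* Main.v *)
Require Import Defs.
From mathcomp Require Import all_boot all_order all_fingroup all_algebra.
From mathcomp Require Import all_solvable all_field all_character.
From mathcomp Require Import ring.

(** If the second claim fails, Baer-Suzuki in G / C_G(P) gives a conjugate y of
    x such that L = <x, y> does not act on P as a p-group. By coprime action, L
    then acts nontrivially on some LP-chief factor W of P, on which X = x - 1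
    and Y = y - 1 have square zero. Z = XY + YX commutes with L, so k = F_p[Z]
    is a field by Schur's lemma, and a k-plane spanned by v in ker X and vY is
    a 2-dimensional representation of L of determinant 1.

    In place of Dickson's theorem, a counting argument in SL_2(k) finds u, v in
    L of trace 2 with tr(uv) = -2, i.e. U^2 = V^2 = 0 and UV + VU = -4 for
    U = u - 1 and V = v - 1. Since -4 lies in F_p, the F_p-span of e in ker U
    and eV is a natural SL_2(p)-module for <u, v> inside W. As -1 acts on it
    without fixed points, a Frattini argument splits the extension and yields a
    section of G isomorphic to Qd(p).

    The first claim follows from the second: O_p(G mod C_G(P)) acts on a chief
    factor V / U as a p-group, so it centralizes it by minimality. *)

Set Implicit Arguments.
Unset Strict Implicit.
Unset Printing Implicit Defensive.

Import GRing.Theory.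
Local Open Scope group_scope.

(** * Two by two matrices *)

Section Matrix2.

Variable k : comNzRingType.
Implicit Types A B : 'M[k]_2.
Local Open Scope ring_scope.

Lemma mulmx2E m n (A : 'M[k]_(m, 2)) (B : 'M[k]_(2, n)) i j :
  (A *m B) i j = A i 0 * B 0 j + A i 1 * B 1 j.
Proof.
rewrite mxE !big_ord_recl big_ord0 addr0.
by congr (A i _ * B _ j + A i _ * B _ j); apply: val_inj.
Qed.

Lemma mxtrace2E A : \tr A = A 0 0 + A 1 1.
Proof.
rewrite /mxtrace !big_ord_recl big_ord0 addr0.
by congr (A _ _ + A _ _); apply: val_inj.
Qed.

Lemma det2E A : \det A = A 0 0 * A 1 1 - A 0 1 * A 1 0.
Proof.
rewrite (expand_det_row A 0) !big_ord_recl big_ord0 addr0 /cofactor !det_mx11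
  !mxE /= expr0 expr1.
have -> : lift 0 0 = 1 :> 'I_2 by apply: val_inj.
have -> : lift 1 0 = 0 :> 'I_2 by apply: val_inj.
ring.
Qed.

Lemma ord2E (i : 'I_2) : i = 0 \/ i = 1.
Proof. by case: i => [[|[|//]] ?]; [left | right]; apply: val_inj. Qed.

Lemma mx2P A B :
  [/\ A 0 0 = B 0 0, A 0 1 = B 0 1, A 1 0 = B 1 0 & A 1 1 = B 1 1] -> A = B.
Proof.
by case=> *; apply/matrixP=> i j; case: (ord2E i) => ->; case: (ord2E j) => ->.
Qed.

Definition mx2 a b c d : 'M[k]_2 :=
  \matrix_(i, j)
    if i == 0 then if j == 0 then a else b else if j == 0 then c else d.

Lemma mx2E A : A = mx2 (A 0 0) (A 0 1) (A 1 0) (A 1 1).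
Proof. by apply: mx2P; rewrite !mxE. Qed.

Lemma mx2M a b c d a' b' c' d' :
  mx2 a b c d *m mx2 a' b' c' d' =
  mx2 (a * a' + b * c') (a * b' + b * d') (c * a' + d * c') (c * b' + d * d').
Proof. by apply: mx2P; rewrite !mulmx2E !mxE. Qed.

Lemma mxtrace_sqr2 A : \tr (A *m A) = \tr A ^+ 2 - \det A *+ 2.
Proof. rewrite !mxtrace2E det2E !mulmx2E; ring. Qed.

(** Cayley-Hamilton: the characteristic polynomial of [A] is (t - 1)^2. *)
Lemma unipotent2_sqr A :
  \det A = 1 -> \tr A = 2%:R -> (A - 1%:M) *m (A - 1%:M) = 0.
Proof.
rewrite mxtrace2E det2E => dA tA;
  have eA : A 1 1 = 2%:R - A 0 0 by rewrite -tA; ring.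
have dA' : A 0 1 * A 1 0 = A 0 0 * (2%:R - A 0 0) - 1 by rewrite -eA -dA; ring.
apply: mx2P; rewrite !mulmx2E !mxE /= eA; split; ring: dA'.
Qed.

(** For 2 x 2 matrices U, V of trace 0, polarizing Cayley-Hamilton gives UV + VU = tr(UV). Here
    tr(UV) = tr(AB) - tr A - tr B + 2 = -4. *)
Lemma unipotent2_anticomm A B :
  \tr A = 2%:R -> \tr B = 2%:R -> \tr (A *m B) = - 2%:R ->
  (A - 1%:M) *m (B - 1%:M) + (B - 1%:M) *m (A - 1%:M) = - 4%:R%:M.
Proof.
rewrite !mxtrace2E !mulmx2E => tA tB.
have -> : A 1 1 = 2%:R - A 0 0 by rewrite -tA; ring.
have eB : B 1 1 = 2%:R - B 0 0 by rewrite -tB; ring.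
have eA : A 1 1 = 2%:R - A 0 0 by rewrite -tA; ring.
rewrite eB => tAB.
have e : A 0 1 * B 1 0 = - 2%:R - (A 0 0 * B 0 0 +
    (A 1 0 * B 0 1 + (2%:R - A 0 0) * (2%:R - B 0 0))) by rewrite -tAB; ring.
apply: mx2P; split; rewrite mxE !mulmx2E !mxE /= ?eA ?eB; ring: e.
Qed.

End Matrix2.

(** * Unipotent pairs in finite subgroups of SL_2(k) *)

Section UnipotentPair.

Variables (k : fieldType) (p : nat) (gT : finGroupType) (L : {group gT}).
Variables (rL : mx_representation k L 2) (u0 g0 : gT).
Hypotheses (odd_p : odd p) (char_k : (p%:R = 0 :> k)%R).
Hypotheses (injL : mx_faithful rL) (detL : {in L, forall g, (\det (rL g) =
  1)%R}).
Hypotheses (Lu0 : u0 \in L) (ntu0 : u0 != 1).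
Hypotheses (u0_00 : rL u0 0%R 0%R = 1%R) (u0_01 : rL u0 0%R 1%R = 0%R).
Hypotheses (Lg0 : g0 \in L) (g0_01 : rL g0 0%R 1%R != 0%R).

(* With row vectors and e = (1, 0): M stabilizes the line <e>, Q stabilizes e,
   and E consists of the unipotent elements of L that move <e>. *)
Let M := [set g in L | rL g 0%R 1%R == 0%R].
Let Q := [set g in M | rL g 0%R 0%R == 1%R].
Let E := [set g in L :\: M | (\tr (rL g) == 2%:R)%R].

Let sML : M \subset L. Proof. by apply/subsetP=> g /setIdP[]. Qed.
Let M01 g : g \in M -> rL g 0%R 1%R = 0%R. Proof. by case/setIdP=> _ /eqP. Qed.

Let repM g h : g \in L -> h \in L -> rL (g * h) = (rL g *m rL h)%R.
Proof. exact: repr_mxM. Qed.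

Let det2L g : g \in L ->
  (rL g 0 0 * rL g 1 1 - rL g 0 1 * rL g 1 0 = 1)%R.
Proof. by move=> Lg; rewrite -det2E detL. Qed.

Let group_set_M : group_set M.
Proof.
apply/group_setP; split=> [|g h Mg Mh].
  by rewrite inE group1 repr_mx1 mxE eqxx.
have [Lg Lh] := (subsetP sML _ Mg, subsetP sML _ Mh).
by rewrite inE groupM // repM // mulmx2E !M01 // mulr0 mul0r addr0 eqxx.
Qed.
Canonical M_group := Group group_set_M.

Let diagM g : g \in M -> (rL g 0 0 * rL g 1 1 = 1)%R.
Proof.
by move=> Mg; rewrite -(det2L (subsetP sML _ Mg)) M01 // mul0r subr0.
Qed.

Let diagM_neq0 g : g \in M -> (rL g 0 0 != 0)%R.
Proof.
move/diagM=> e; apply/eqP=> z; move/eqP: e.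
by rewrite z mul0r eq_sym oner_eq0.
Qed.

Let sQM : Q \subset M. Proof. by apply/subsetP=> g /setIdP[]. Qed.

Let Q00 q : q \in Q -> (rL q 0 0 = 1)%R. Proof. by case/setIdP=> _ /eqP. Qed.

Let Q11 q : q \in Q -> (rL q 1 1 = 1)%R.
Proof. by move=> Qq; have:= diagM (subsetP sQM _ Qq); rewrite Q00 // mul1r. Qed.

(** Elements of [Q] act by lower unitriangular matrices, and the action is faithful. *)
Let Q10 q : q \in Q -> (rL q 1 0 = 0)%R -> q = 1.
Proof.
move=> Qq q10; have Mq := subsetP sQM _ Qq; have Lq := subsetP sML _ Mq.
apply/set1gP; apply: (subsetP injL); rewrite inE Lq mul1mx; apply/eqP.
by apply: mx2P; rewrite !mxE Q00 // M01 // q10 Q11.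
Qed.

Let Mu0 : u0 \in M. Proof. by rewrite inE Lu0 u0_01 eqxx. Qed.
Let Qu0 : u0 \in Q. Proof. by rewrite inE Mu0 u0_00 eqxx. Qed.

Let conjQ q m : q \in Q -> m \in M -> q ^ m \in Q.
Proof.
move=> Qq Mm; have Mq := subsetP sQM _ Qq.
have Mqm : q ^ m \in M by rewrite groupJ.
have [[Lq Lm] Lqm] := (subsetP sML _ Mq, subsetP sML _ Mm, subsetP sML _ Mqm).
have: rL (m * q ^ m) = rL (q * m) by rewrite conjgE mulKVg.
move/matrixP/(_ 0 0)%R;
  rewrite (repM Lm Lqm) (repM Lq Lm) !mulmx2E (M01 Mm) (M01 Mq) (Q00 Qq).
rewrite !mul0r mul1r !addr0 => e; apply/setIdP; split=> //; apply/eqP.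
by apply: (mulfI (diagM_neq0 Mm)); rewrite e mulr1.
Qed.

(** The unipotent [q ^ g] fixes the vector e g, which lies off the line <e>. If it stabilized <e> as
    well, it would be trivial. *)
Let conjQ_E q g : q \in Q^# -> g \in L :\: M -> q ^ g \in E.
Proof.
case/setD1P=> ntq Qq /setDP[Lg M'g]; have Mq := subsetP sQM _ Qq.
have Lq := subsetP sML _ Mq; have Lqg : q ^ g \in L by rewrite groupJ.
have ntg : (rL g 0 1 != 0)%R by move: M'g; rewrite inE Lg.
have eqg : rL (g * q ^ g) = rL (q * g) by rewrite conjgE mulKVg.
have tr2 : (\tr (rL (q ^ g)%g) = 2%:R)%R.
  rewrite conjgE repM ?groupM ?groupV // mxtrace_mulC -repM ?groupM ?groupV //.
  by rewrite mulgK mxtrace2E (Q00 Qq) (Q11 Qq).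
apply/setIdP; rewrite tr2; split=> //; apply/setDP; split=> //.
apply: contra ntq => Mqg.
have:= eqg; rewrite (repM Lg Lqg) (repM Lq Lg) => /matrixP e.
have:= e 0%R 1%R; have:= e 1%R 1%R;
  rewrite !mulmx2E (M01 Mqg) (M01 Mq) (Q00 Qq) (Q11 Qq).
rewrite !mul0r !mul1r !mulr0 !addr0 !add0r => e11 e01.
have v11 : (rL (q ^ g)%g 1 1 = 1)%R by apply: (mulfI ntg); rewrite e01 mulr1.
move: e11; rewrite v11 mulr1 -[LHS]add0r => /addIr/esym/eqP.
by rewrite mulf_eq0 (negPf ntg) orbF => /eqP/(Q10 Qq)->.
Qed.

(** An element of [Q :^ g] fixes the vector e g, and a nontrivial unipotent fixes only one line, so
    e g and e g' span the same line. *)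
Let fixed_line v g g' :
  g \in L -> g' \in L -> v \in E -> v \in Q :^ g -> v \in Q :^ g' ->
  g' \in M :* g.
Proof.
move=> Lg Lg' Ev; rewrite !mem_conjg => Qq Qq'.
set q := v ^ _ in Qq; set q' := v ^ _ in Qq'.
rewrite mem_rcoset; set h := g' * _;
  have Lh : h \in L by rewrite groupM ?groupV.
have ntq : (rL q 1 0 != 0)%R.
  apply/eqP=> /(Q10 Qq)/eqP; rewrite conjg_eq1 => /eqP v1.
  by move: Ev; rewrite v1 !inE group1 repr_mx1 mxE eqxx.
have [Lq Lq'] : q \in L /\ q' \in L.
  by split; apply: (subsetP sML); apply: (subsetP sQM).
have: rL (h * q) = rL (q' * h).
  by rewrite /h /q /q' !conjgE !invgK !mulgA !mulgKV.
move/matrixP/(_ 0 0)%R; rewrite (repM Lh Lq) (repM Lq' Lh) !mulmx2E.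
rewrite (M01 (subsetP sQM _ Qq')) (Q00 Qq) (Q00 Qq') mul0r mul1r mulr1 addr0.
rewrite -[RHS]addr0 => /addrI/eqP; rewrite mulf_eq0 (negPf ntq) orbF => h01.
by rewrite inE Lh.
Qed.

(* Average over g in L \ M: each v in E lies in M :* g for exactly #|M| such
   g and in Q :^ g for at most #|M| of them, while Q^# :^ g is contained in E.
     *)
Let exists_rich_coset : exists2 g, g \in L :\: M & #|Q^#| <= #|E :&: M :* g|.
Proof.
have [/exists_inP[g] | noG] := boolP [exists g in L :\: M, #|Q^#| <= #|E :&: M
  :* g|].
  by exists g.
have: \sum_(g in L :\: M) #|E :&: M :* g| < \sum_(g in L :\: M) #|Q^#|.
  have LMg0 : g0 \in L :\: M by rewrite !inE Lg0 g0_01.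
  rewrite (bigD1 g0) // [X in _ < X](bigD1 g0) //= -addSn leq_add //.
    by move: noG; rewrite negb_exists_in => /forall_inP/(_ _ LMg0);
      rewrite -ltnNge.
  apply: leq_sum => g /andP[LMg _].
  by move: noG; rewrite negb_exists_in => /forall_inP/(_ _ LMg);
    rewrite -ltnNge => /ltnW.
rewrite ltnNge => /negP[].
have sumE (F : gT -> {set gT}) :
    \sum_(g in L :\: M) #|E :&: F g| = \sum_(v in E) #|[set g in L :\: M | v
      \in F g]|.
  under eq_bigr do rewrite -sum1_card big_mkcond /=.
  rewrite exchange_big /= [RHS]big_mkcond /=; apply: eq_bigr => v _.
  case: ifP => Ev.
    rewrite -sum1_card big_mkcond /= [RHS]big_mkcond /=; apply: eq_bigr => g _.
    by rewrite in_setI Ev [in RHS]inE; case: (g \in _).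
  by rewrite big1 // => g _; rewrite in_setI Ev.
apply: (@leq_trans (\sum_(g in L :\: M) #|E :&: Q :^ g|)).
  apply: leq_sum => g LMg; rewrite -(cardJg _ g); apply: subset_leq_card.
  apply/subsetP=> _ /imsetP[q Qq ->]; rewrite in_setI conjQ_E //.
  by rewrite memJ_conjg; case/setD1P: Qq.
rewrite !sumE; apply: leq_sum => v Ev.
have [Lv M'v] : v \in L /\ v \notin M by case/setIdP: Ev => /setDP[].
have -> : [set g in L :\: M | v \in M :* g] = M :* v.
  apply/setP=> g; rewrite inE [v \in _]rcoset_sym andb_idl // => /rcosetP[m Mm
    ->].
  have Lm := subsetP sML m Mm.
  by apply/setDP; rewrite groupM //; split=> //; rewrite groupMl.
rewrite card_rcoset.
have [-> | [g]] := set_0Vmem [set g in L :\: M | v \in Q :^ g].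
  by rewrite cards0.
case/setIdP=> /setDP[Lg _] Qgv; rewrite -(card_rcoset M g).
apply/subset_leq_card/subsetP=> g' /setIdP[/setDP[Lg' _] Qg'v].
exact: fixed_line Lg Lg' Ev Qgv Qg'v.
Qed.

(* If no such pair exists, m |-> u0 ^ m is injective on the m in M with m * v
   in E, as elements of M centralizing u0 have the form +-q with q in Q. For v
   in a rich coset it is then onto Q^#, so u0 ^ m = u0^-1 for one such m. Then
   m^2 = -1 and tr(v * v^m) = - tr((vm)^2) = 2 det(vm) - tr(vm)^2 = -2. *)
Theorem unipotent_pair :
  exists u v, [/\ u \in L, v \in L, (\tr (rL u) = 2%:R)%R,
    (\tr (rL v) = 2%:R)%R & (\tr (rL (u * v)%g) = - 2%:R)%R].
Proof.
pose bad u v := [&& u \in L, v \in L, \tr (rL u) == 2%:R,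
    \tr (rL v) == 2%:R & \tr (rL (u * v)%g) == - 2%:R]%R.
have [/existsP[u /existsP[v /and5P[Lu Lv /eqP tu /eqP tv /eqP tuv]]] | nobad] :=
  boolP [exists u, exists v, bad u v]; first by exists u, v.
have {bad nobad} noL u v : u \in L -> v \in L -> (\tr (rL u) = 2%:R)%R ->
    (\tr (rL v) = 2%:R)%R -> (\tr (rL (u * v)%g) = - 2%:R)%R -> False.
  move=> Lu Lv tu tv tuv; case/negP: nobad; apply/existsP; exists u.
  by apply/existsP; exists v; rewrite /bad Lu Lv tu tv tuv !eqxx.
have Q1u0 : u0 \in Q^# by apply/setD1P.
have [g LMg rich] := exists_rich_coset.
have [v /setIP[Ev Mgv]] : exists v, v \in E :&: M :* g.
  apply/set0Pn; rewrite -card_gt0; apply: leq_trans rich.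
  by rewrite card_gt0; apply/set0Pn; exists u0.
have eMg : M :* g = M :* v by apply/rcoset_eqP; rewrite rcoset_sym in Mgv.
rewrite {g LMg Mgv} eMg in rich.
have [/setDP[Lv M'v] tv] : v \in L :\: M /\ (\tr (rL v) = 2%:R)%R.
  by case/setIdP: Ev => ? /eqP.
have EP w : w \in E :&: M :* v ->
    [/\ w \in L, w * v^-1 \in M, (rL w 0 1 != 0)%R & (\tr (rL w) = 2%:R)%R].
  case/setIP=> /setIdP[/setDP[Lw M'w] /eqP tw]; rewrite mem_rcoset => Mwv.
  by split=> //; apply: contra M'w => ?; apply/setIdP.
pose f w := u0 ^ (w * v^-1).
have n_neq0 : (rL u0 1 0 != 0)%R by apply: contra ntu0 => /eqP/(Q10 Qu0)->.
have injf : {in E :&: M :* v &, injective f}.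
  move=> w w' /EP[Lw Mm w01 tw] /EP[Lw' Mm' _ tw'] /(congr1 (conjg^~ (w *
    v^-1)^-1)).
  rewrite /f conjgK -conjgM; set d := w' * v^-1 * _ => cu0.
  have Md : d \in M by rewrite groupM ?groupV.
  have Ld := subsetP sML _ Md.
  have ew' : w' = d * w by rewrite /d invMg invgK !mulgA !mulgKV.
  (* As [d] centralizes [u0], whose (1, 0) entry is nonzero, its two diagonal entries agree; their
     product is 1, so both are 1 or both are -1. *)
  have : rL (u0 * d) = rL (d * u0) by rewrite [in RHS]cu0 conjgE mulKVg.
  rewrite (repM Lu0 Ld) (repM Ld Lu0) => /matrixP/(_ 1 0)%R.
  rewrite !mulmx2E (Q00 Qu0) (Q11 Qu0) mul1r mulr1 addrC => /addrI.
  rewrite [RHS]mulrC => /(mulfI n_neq0) d_diag.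
  have := diagM Md; rewrite -d_diag -expr2 => /eqP; rewrite sqrf_eq1.
  move: (tw'); rewrite ew' repM // mxtrace2E !mulmx2E (M01 Md) mul0r addr0
    -d_diag.
  move=> tdw /predU1P[d00 | /eqP d00]; move: tdw; rewrite d00.
    rewrite !mul1r -tw mxtrace2E addrCA -[RHS]add0r => /addIr/eqP.
    rewrite mulf_eq0 (negPf w01) orbF => /eqP d10.
    by rewrite (Q10 _ d10) ?mul1g //; apply/setIdP; rewrite d00.
  (* Here [d] is the negative of a lower unitriangular matrix, so [d ^+ p] acts as -1, because p is
     odd and vanishes in [k]. Then [d ^+ p * d] has trace 2 and its product with [w], namely
     [d ^+ p * w'], has trace -2: an excluded pair. *)
  move=> tdw; have dX i : (rL (d ^+ i)%g 0 1 = 0 /\ rL (d ^+ i)%g 0 0 = (-1) ^+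
    i /\
      rL (d ^+ i)%g 1 1 = (-1) ^+ i /\ rL (d ^+ i)%g 1 0 = - (-1) ^+ i * i%:R *
        rL d 1 0)%R.
    elim: i => [|i [e01 [e00 [e11 e10]]]].
      by rewrite expg0 repr_mx1 !mxE; do !split=> //; rewrite mulr0 mul0r.
    rewrite expgSr repM ?groupX // !mulmx2E (M01 Md) -d_diag d00 e01 e00 e11
      e10.
    rewrite -natr1 exprS; do !split; ring.
  have [z01 [z00 [z11 z10]]] := dX p.
  have rLz : rL (d ^+ p) = (- 1%:M)%R.
    rewrite -signr_odd odd_p expr1 in z00 z11 z10.
    apply: mx2P; rewrite !mxE z01 z00 z11 z10 char_k /= mulr0n oppr0.
    by split=> //; rewrite mulr0 mul0r.
  have Lz : d ^+ p \in L by rewrite groupX.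
  case: (noL (d ^+ p * d) w) => //; first by rewrite groupM.
    by rewrite repM // rLz mulNmx mul1mx raddfN /= mxtrace2E -d_diag d00 -opprD
      opprK.
  rewrite -mulgA -ew' repM // rLz mulNmx mul1mx raddfN /= tw' //.
have sfQ : f @: (E :&: M :* v) \subset Q^#.
  apply/subsetP=> _ /imsetP[w /EP[_ Mm _ _] ->]; apply/setD1P.
  by rewrite conjg_eq1 conjQ.
have {injf sfQ} imf : f @: (E :&: M :* v) = Q^#.
  by apply/eqP; rewrite eqEcard sfQ card_in_imset.
have : u0^-1 \in Q^#.
  apply/setD1P; rewrite eq_invg1; split=> //;
    have LVu0 : u0^-1 \in L by rewrite groupV.
  have MVu0 : u0^-1 \in M by rewrite groupV.
  apply/setIdP; split=> //; apply/eqP.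
  have: (rL (u0 * u0^-1)%g = 1%:M)%R by rewrite mulgV repr_mx1.
  rewrite repM // => /matrixP/(_ 0 0)%R.
  by rewrite mulmx2E (Q00 Qu0) u0_01 mul0r mul1r addr0 mxE.
rewrite -imf => /imsetP[w /EP[Lw Mm w01 tw]]; rewrite /f;
  set m := w * v^-1 => cu0.
have Lm : m \in L := subsetP sML _ Mm.
(* The (1, 0) entry of this relation says that tr(m) times the nonzero (1, 0) entry of [u0]
   vanishes. Trace 0 and determinant 1 then give m^2 = -1. *)
have umu : u0 * (m * u0) = m.
  by rewrite mulgA (conjgC u0) -cu0 mulgKV.
have tm : (\tr (rL m) = 0)%R.
  have Lmu : m * u0 \in L by rewrite groupM.
  have: rL (u0 * (m * u0)) = rL m by rewrite umu.
  rewrite (repM Lu0 Lmu) (repM Lm Lu0) => /matrixP/(_ 1 0)%R.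
  rewrite !mulmx2E (Q00 Qu0) (Q11 Qu0) (M01 Mm) mxtrace2E => e.
  by apply: (mulfI n_neq0);
    rewrite mulr0 -(subrr (rL m 1%R 0%R)) -[X in _ = (X - _)%R]e; ring.
have mm : (rL m *m rL m = - 1%:M)%R.
  have := det2L Lm; move: tm; rewrite mxtrace2E (M01 Mm) => /eqP.
  rewrite addr_eq0 => /eqP e00; rewrite e00 => dm.
  have {dm} dm : (rL m 1 1 * rL m 1 1 = - 1)%R by rewrite -dm; ring.
  by apply: mx2P; rewrite !mulmx2E !mxE /= (M01 Mm) e00; split; ring: dm.
have rLVm : (rL m^-1%g = - rL m)%R.
  have LVm : m^-1 \in L by rewrite groupV.
  have: (rL (m^-1 * m)%g = 1%:M)%R by rewrite mulVg repr_mx1.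
  rewrite repM // => /(congr1 (mulmx^~ (rL m))).
  by rewrite -mulmxA mm mul1mx mulmxN mulmx1 => <-; rewrite opprK.
have Lvm : v ^ m \in L by rewrite groupJ.
case: (noL v (v ^ m)) => //.
  rewrite conjgE repM ?groupM ?groupV // mxtrace_mulC -repM ?groupM ?groupV //.
  by rewrite mulgK.
have tvm : (\tr (rL v *m rL m) = 2%:R)%R.
  by rewrite mxtrace_mulC -repM // /m mulgKV.
rewrite repM // conjgE (repM (groupVr Lm)) ?groupM ?groupV // repM // rLVm.
rewrite mulNmx mulmxN mulmxA raddfN /= mxtrace_sqr2 tvm det_mulmx !detL //
  mulr1.
ring.
Qed.

End UnipotentPair.

(** * Pairs of quadratic elements *)

(** Keeping the given basis [B] lets the restricted representation be computed as explicit
    matrices. *)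
Lemma mxmodule_basis_repr (k : fieldType) (gT : finGroupType) (G : {group gT})
    (n m : nat) (rG : mx_representation k G n) (B : 'M[k]_(m, n)) :
  row_free B -> mxmodule rG B ->
  exists rB : mx_representation k G m,
    {in G, forall g, (rB g *m B = B *m rG g)%R}.
Proof.
move=> freeB /mxmoduleP modB; pose r g := (B *m rG g *m pinvmx B)%R.
have rE g : g \in G -> (r g *m B = B *m rG g)%R.
  by move=> Gg; rewrite mulmxKpV // modB.
have rP : mx_repr G r.
  split=> [|g h Gg Gh]; apply: (row_free_inj freeB).
    by rewrite rE // repr_mx1 mulmx1 mul1mx.
  by rewrite rE ?groupM // repr_mxM // -mulmxA !rE // !mulmxA rE.
by exists (MxRepresentation rP).
Qed.

Lemma kermx_sqr0_neq0 (k : fieldType) n (X : 'M[k]_n.+1) :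
  (X *m X = 0 -> kermx X != 0)%R.
Proof.
move=> XX; rewrite kermx_eq0; apply/negP=> /row_free_inj freeX.
have X0 : X = 0%R by apply: freeX; rewrite XX mul0mx.
have /matrixP/(_ 0 0)%R : 1%:M%R = 0%R :> 'M[k]_n.+1.
  by apply: freeX; rewrite X0 !mulmx0.
by rewrite !mxE => /eqP; rewrite oner_eq0.
Qed.

Lemma repr_gen_det1 (k : fieldType) (gT : finGroupType) (A : {set gT})
    (n : nat) (rA : mx_representation k <<A>> n) :
  {in A, forall g, (\det (rA g) = 1)%R} ->
  {in <<A>>, forall g, (\det (rA g) = 1)%R}.
Proof.
move=> detA; pose D := [set g in <<A>> | (\det (rA g) == 1)%R].
have gD : group_set D.
  apply/group_setP; split=> [|g h];
    first by rewrite inE group1 repr_mx1 det1 eqxx.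
  rewrite !inE => /andP[Ag /eqP dg] /andP[Ah /eqP dh].
  by rewrite groupM // repr_mxM // det_mulmx dg dh mulr1 eqxx.
have sAD : <<A>> \subset Group gD.
  by rewrite gen_subG; apply/subsetP=> g Ag;
    rewrite inE mem_gen // detA // eqxx.
by move=> g /(subsetP sAD); rewrite inE => /andP[_ /eqP].
Qed.

Section QuadraticPair.

Variables (k : fieldType) (p : nat) (gT : finGroupType) (x y : gT).
Let L := <<[set x; y]>>%G.
Hypotheses (odd_p : odd p) (char_k : (p%:R = 0 :> k)%R).

Let Lx : x \in L. Proof. by rewrite mem_gen // !inE eqxx. Qed.
Let Ly : y \in L. Proof. by rewrite mem_gen // !inE eqxx orbT. Qed.

(** In the basis v0, v0 Y, with X = x - 1 and Y = y - 1, both generators act as transvections;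
    independence holds because X sends a v0 + b v0 Y to b z v0. This serves twice: over the field
    generated by Z for x and y, and over F_p with z = -4 for the pair u, v. *)
Lemma natural_basis m (rL : mx_representation k L m) (z : k) (v0 : 'rV_m) :
  (v0 != 0 -> z != 0 -> v0 *m (rL x - 1%:M) = 0 ->
  v0 *m (rL y - 1%:M) *m (rL x - 1%:M) = z *: v0 ->
  v0 *m (rL y - 1%:M) *m (rL y - 1%:M) = 0 ->
  exists (rB : mx_representation k L 2) (B : 'M_(2, m)),
    [/\ row_free B, {in L, forall g, rB g *m B = B *m rL g},
        rB x = mx2 1 0 z 1, rB y = mx2 1 1 0 1
      & {in L, forall g, \det (rB g) = 1}])%R.
Proof.
set X := (rL x - _)%R; set Y := (rL y - _)%R => nz_v0 nz_z v0X v0YX v0YY.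
have xE : (rL x = X + 1%:M)%R by rewrite subrK.
have yE : (rL y = Y + 1%:M)%R by rewrite subrK.
clearbody X Y.
pose B : 'M_(2, m) := (\matrix_i if i == 0 then v0 else v0 *m Y)%R.
have B0 : (row 0 B = v0)%R by rewrite rowK.
have B1 : (row 1 B = v0 *m Y)%R by rewrite rowK.
clearbody B.
have B0j j : (B 0 j = v0 0 j)%R by rewrite -B0 mxE.
have B1j j : (B 1 j = (v0 *m Y) 0 j)%R by rewrite -B1 mxE.
have BE (a : 'rV_2) : (a *m B = a 0 0 *: v0 + a 0 1 *: (v0 *m Y))%R.
  apply/rowP=> j; rewrite mulmx2E [RHS]mxE [X in _ = (X + _)%R]mxE.
  by rewrite [X in _ = (_ + X)%R]mxE B0j B1j.
have freeB : row_free B.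
  apply: inj_row_free => a; rewrite BE => aB.
  have a1 : (a 0 1 = 0)%R.
    move/(congr1 (mulmx^~ X)): (aB);
      rewrite mul0mx mulmxDl -!scalemxAl v0X v0YX.
    rewrite scaler0 add0r scalerA => /eqP;
      rewrite scaler_eq0 (negPf nz_v0) orbF.
    by rewrite mulf_eq0 (negPf nz_z) orbF => /eqP.
  move: aB; rewrite a1 scale0r addr0 => /eqP;
    rewrite scaler_eq0 (negPf nz_v0) orbF.
  by move/eqP=> a0; apply/rowP=> j; case: (ord2E j) => ->; rewrite mxE.
have modB : mxmodule rL B.
  have sB i : (row i B <= B)%MS by apply: row_sub.
  rewrite /mxmodule gen_subG; apply/subsetP=> g; rewrite !inE.
  case/pred2P=> ->; rewrite ?Lx ?Ly ?xE ?yE mulmxDr mulmx1 addmx_sub //.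
    apply/row_subP=> i; rewrite row_mul.
    by case: (ord2E i) => ->;
      rewrite ?B0 ?B1 ?v0X ?v0YX ?sub0mx ?scalemx_sub -?B0.
  apply/row_subP=> i; rewrite row_mul.
  by case: (ord2E i) => ->; rewrite ?B0 ?B1 ?v0YY ?sub0mx -?B1.
have [rB rBE] := mxmodule_basis_repr freeB modB.
pose r2 (a b : k) : 'rV_2 := (\row_j if j == 0 then a else b)%R.
have r2E a b : (r2 a b *m B = a *: v0 + b *: (v0 *m Y))%R by rewrite BE !mxE.
have rowx0 : (row 0 (rB x) = r2 1 0)%R.
  apply: (row_free_inj freeB); rewrite -row_mul rBE // r2E row_mul B0 xE.
  by rewrite mulmxDr v0X mulmx1 add0r scale1r scale0r addr0.
have rowx1 : (row 1 (rB x) = r2 z 1)%R.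
  apply: (row_free_inj freeB); rewrite -row_mul rBE // r2E row_mul B1 xE.
  by rewrite mulmxDr v0YX mulmx1 scale1r.
have rowy0 : (row 0 (rB y) = r2 1 1)%R.
  apply: (row_free_inj freeB); rewrite -row_mul rBE // r2E row_mul B0 yE.
  by rewrite mulmxDr mulmx1 !scale1r addrC.
have rowy1 : (row 1 (rB y) = r2 0 1)%R.
  apply: (row_free_inj freeB); rewrite -row_mul rBE // r2E row_mul B1 yE.
  by rewrite mulmxDr v0YY mulmx1 scale1r scale0r.
have entry (A : 'M[k]_2) a b c d :
    row 0%R A = r2 a b -> row 1%R A = r2 c d -> A = mx2 a b c d.
  move=> /rowP e0 /rowP e1; have:= (e0 0%R, e0 1%R, (e1 0%R, e1 1%R)).
  by rewrite !mxE => -[[e00 e01] [e10 e11]]; apply: mx2P; rewrite !mxE.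
have eqx := entry _ _ _ _ _ rowx0 rowx1;
  have eqy := entry _ _ _ _ _ rowy0 rowy1.
exists rB, B; split=> //; apply: repr_gen_det1 => g; rewrite !inE.
by case/pred2P=> ->; rewrite det2E (eqx, eqy) !mxE /= ?(mul1r, mul0r, mulr0,
  subr0).
Qed.

(** [L] need not act faithfully on the plane, so [unipotent_pair] is applied modulo [rker rB] and
    the pair is lifted. Since [u] and [v] are controlled on that plane only, the conclusion concerns
    a single vector [e] of it. *)
Lemma quadratic_pair_scalar m (rL : mx_representation k L m) (z : k) (v0 :
  'rV_m) :
  (v0 != 0 -> v0 *m (rL x - 1%:M) = 0 -> z != 0 ->
  (rL y - 1%:M) *m (rL y - 1%:M) = 0 ->
  (rL x - 1%:M) *m (rL y - 1%:M) + (rL y - 1%:M) *m (rL x - 1%:M) = z%:M ->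
  exists u v (e : 'rV_m), [/\ u \in L, v \in L, e != 0,
    e *m (rL u - 1%:M) = 0 & (e *m (rL v - 1%:M) *m (rL v - 1%:M) = 0 /\
    e *m (rL v - 1%:M) *m (rL u - 1%:M) = - (e *+ 4))])%R.
Proof.
set X := (rL x - _)%R; set Y := (rL y - _)%R => nz_v0 v0X nz_z YY XYYX.
have v0YX : (v0 *m Y *m X = z *: v0)%R.
  by rewrite -mul_mx_scalar -XYYX (mulmxDr v0 (X *m Y)%R) !mulmxA v0X mul0mx
    add0r.
have v0YY : (v0 *m Y *m Y = 0)%R by rewrite -mulmxA YY mulmx0.
have [rB [B [freeB rBE eqx eqy det1]]] := natural_basis nz_v0 nz_z v0X v0YX
  v0YY.
have rB1E g : g \in L -> ((rB g - 1%:M) *m B = B *m (rL g - 1%:M))%R.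
  by move=> Lg; rewrite mulmxBl mulmxBr rBE // mul1mx mulmx1.
have kerx g : g \in L -> kquo_repr rB (coset (rker rB) g) = rB g.
  exact: kquo_repr_coset.
have detq : {in L / rker rB, forall g, (\det (kquo_repr rB g) = 1)%R}.
  by move=> _ /morphimP[g _ Lg ->]; rewrite kerx // det1.
have ntx : coset (rker rB) x != 1.
  apply/eqP=> cx1; have := kerx x Lx;
    rewrite cx1 repr_mx1 => /matrixP/(_ 1 0)%R.
  by rewrite eqx !mxE => /esym/eqP; rewrite (negPf nz_z).
have [||||||ub [vb [Lub Lvb tub tvb tuvb]]] := @unipotent_pair _ _ _ _
  (kquo_repr rB)
    (coset (rker rB) x) (coset (rker rB) y) odd_p char_k (kquo_mx_faithful rB)
      detq.
- exact: mem_quotient.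
- exact: ntx.
- by rewrite kerx // eqx mxE.
- by rewrite kerx // eqx mxE.
- exact: mem_quotient.
- by rewrite kerx // eqy mxE oner_eq0.
case/morphimP: Lub tub tuvb => u Nu Lu ->; case/morphimP: Lvb tvb => v Nv Lv ->.
rewrite -morphM // !kerx ?groupM // repr_mxM // => tv tu tuv.
have UU := unipotent2_sqr (det1 u Lu) tu;
  have VV := unipotent2_sqr (det1 v Lv) tv.
have UVVU := unipotent2_anticomm tu tv tuv.
set U := (rB u - _)%R in UU UVVU; set V := (rB v - _)%R in VV UVVU.
have rU : (U *m B = B *m (rL u - 1%:M))%R by apply: rB1E.
have rV : (V *m B = B *m (rL v - 1%:M))%R by apply: rB1E.
clearbody U V.
have [a nz_a aU] : exists2 a : 'rV_2, (a != 0)%R & (a *m U = 0)%R.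
  exists (nz_row (kermx U)); last by apply/sub_kermxP/nz_row_sub.
  by rewrite nz_row_eq0 kermx_sqr0_neq0.
exists u, v, (a *m B)%R; split=> //.
- by rewrite mulmx_free_eq0.
- by rewrite -mulmxA -rU mulmxA aU mul0mx.
split; rewrite -(mulmxA a B) -rV !mulmxA.
  by rewrite -(mulmxA _ B) -rV mulmxA -(mulmxA a) VV mulmx0 mul0mx.
rewrite -(mulmxA _ B) -rU mulmxA.
(* Evaluate UV + VU = -4 at [a], which U kills. *)
have -> : (a *m V *m U = - (a *+ 4))%R.
  have := congr1 (mulmx a) UVVU; rewrite mulmxDr !mulmxA aU mul0mx add0r => ->.
  by rewrite mulmxN -scaler_nat mul_mx_scalar.
by rewrite mulNmx -!scaler_nat scalemxAl.
Qed.

End QuadraticPair.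

(** * Irreducible modules over the field generated by Z *)

Section IrreducibleQuadraticPair.

Import MatrixGenField.

Variables (F : fieldType) (p : nat) (gT : finGroupType) (x y : gT).
Let L := <<[set x; y]>>%G.
Variables (n' : nat) (rL : mx_representation F L n'.+1).
Hypotheses (odd_p : odd p) (char_F : (p%:R = 0 :> F)%R).
Hypotheses (irrL : mx_irreducible rL).

Let Lx : x \in L. Proof. by rewrite mem_gen // !inE eqxx. Qed.
Let Ly : y \in L. Proof. by rewrite mem_gen // !inE eqxx orbT. Qed.

(** If XY = -YX, then Y preserves ker X, which is therefore a nonzero submodule and by
    irreducibility the whole module. *)
Lemma anticommuting_quadratic_trivial :
  ((rL x - 1%:M) *m (rL x - 1%:M) = 0 ->
  (rL x - 1%:M) *m (rL y - 1%:M) + (rL y - 1%:M) *m (rL x - 1%:M) = 0 ->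
  rL x = 1%:M)%R.
Proof.
set X := (rL x - _)%R; set Y := (rL y - _)%R => XX XYYX.
have xE : (rL x = X + 1%:M)%R by rewrite subrK.
have yE : (rL y = Y + 1%:M)%R by rewrite subrK.
clearbody X Y.
have nzK := kermx_sqr0_neq0 XX.
have modK : mxmodule rL (kermx X).
  rewrite /mxmodule gen_subG; apply/subsetP=> g; rewrite !inE.
  case/pred2P=> ->; rewrite ?Lx ?Ly ?xE ?yE mulmxDr mulmx1 addmx_sub //.
    by rewrite mulmx_ker sub0mx.
  apply/sub_kermxP; rewrite -mulmxA.
  move/eqP: XYYX; rewrite addrC addr_eq0 => /eqP->.
  by rewrite mulmxN mulmxA mulmx_ker mul0mx oppr0.
have [_ _ /(_ _ modK (submx1 _) nzK)/sub_kermxP] := irrL.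
by rewrite mul1mx xE => ->; rewrite add0r.
Qed.

(** Over the field [gen_of irrL cZ] the operator Z becomes the scalar [groot irrL cZ], nonzero by
    the previous lemma. The additive bijection [val_gen] transports the equations both ways; the
    factor 4 is a natural multiple, so it keeps its meaning over [F]. *)
Theorem irreducible_quadratic_pair :
  ((rL x - 1%:M) *m (rL x - 1%:M) = 0 ->
  (rL y - 1%:M) *m (rL y - 1%:M) = 0 -> rL x != 1%:M ->
  exists u v (e : 'rV_n'.+1), [/\ u \in L, v \in L, e != 0,
    e *m (rL u - 1%:M) = 0 & (e *m (rL v - 1%:M) *m (rL v - 1%:M) = 0 /\
    e *m (rL v - 1%:M) *m (rL u - 1%:M) = - (e *+ 4))])%R.
Proof.
move=> XX YY ntx.
pose Z := ((rL x - 1%:M) *m (rL y - 1%:M) + (rL y - 1%:M) *m (rL x - 1%:M))%R.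
have nzZ : Z != 0%R.
  by apply: contraNneq ntx => /(anticommuting_quadratic_trivial XX)->.
have cZ : centgmx rL Z.
  (* Both sides reduce to A B A. *)
  have comm (A B : 'M[F]_n'.+1) :
      (A *m A = 0 -> A *m (A *m B + B *m A) = (A *m B + B *m A) *m A)%R.
    move=> AA; rewrite mulmxDr mulmxDl !mulmxA AA mul0mx add0r.
    by rewrite -(mulmxA B) AA mulmx0 addr0.
  have XZ := comm _ (rL y - 1%:M)%R XX.
  have YZ : ((rL y - 1%:M) *m Z = Z *m (rL y - 1%:M))%R by rewrite [Z]addrC;
    apply: comm.
  rewrite /centgmx gen_subG; apply/subsetP=> g; rewrite !inE.
  case/pred2P=> ->; rewrite ?Lx ?Ly /=; apply/eqP.
    by move: XZ; rewrite -/Z mulmxBl mulmxBr mul1mx mulmx1 => e;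
      apply/esym/(addIr (- Z)%R).
  by move: YZ; rewrite -/Z mulmxBl mulmxBr mul1mx mulmx1 => e;
    apply/esym/(addIr (- Z)%R).
pose rK := gen_repr irrL cZ; pose z := groot irrL cZ.
have vJ m (W : 'M_(m, gen_dim Z)) g :
    g \in L -> val_gen (W *m (rK g - 1%:M))%R = (val_gen W *m (rL g - 1%:M))%R.
  by move=> Lg; rewrite mulmxBr mulmx1 val_genD val_genN val_genJ // mulmxBr
    mulmx1.
have vinj m : injective (@val_gen F gT L n' rL Z irrL cZ m) := can_inj
  (val_genK (m := m)).
have nz_z : z != 0%R.
  by apply: contraNneq nzZ => z0; rewrite -(mxval_groot irrL cZ) -/z z0 mxval0.
have char_K : (p%:R = 0 :> gen_of irrL cZ)%R.
  by rewrite -(rmorph_nat (gen irrL cZ)) char_F rmorph0.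
have vJJ m (W : 'M_(m, gen_dim Z)) g h : g \in L -> h \in L ->
    val_gen (W *m ((rK g - 1%:M) *m (rK h - 1%:M)))%R
      = (val_gen W *m ((rL g - 1%:M) *m (rL h - 1%:M)))%R.
  by move=> Lg Lh; rewrite !mulmxA !vJ.
have YYK : ((rK y - 1%:M) *m (rK y - 1%:M) = 0)%R.
  apply: vinj; have := vJJ _ 1%:M%R y y Ly Ly.
  by rewrite mul1mx YY mulmx0 val_gen0.
have XYYXK : ((rK x - 1%:M) *m (rK y - 1%:M) + (rK y - 1%:M) *m (rK x - 1%:M) =
  z%:M)%R.
  apply: vinj; have := vJJ _ 1%:M%R x y Lx Ly; have := vJJ _ 1%:M%R y x Ly Lx.
  rewrite !mul1mx val_genD => -> ->; rewrite -mulmxDr.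
  by rewrite -(scalemx1 _ z) val_genZ mxval_groot.
have [w nz_w wX] : exists2 w : 'rV_n'.+1, (w != 0)%R & (w *m (rL x - 1%:M) =
  0)%R.
  exists (nz_row (kermx (rL x - 1%:M))); last by apply/sub_kermxP/nz_row_sub.
  by rewrite nz_row_eq0 kermx_sqr0_neq0.
have nz_v : in_gen irrL cZ w != 0%R.
  by apply: contraNneq nz_w => w0; rewrite -(in_genK irrL cZ w) w0 val_gen0.
have vX : (in_gen irrL cZ w *m (rK x - 1%:M) = 0)%R.
  by apply: vinj; rewrite vJ // in_genK wX val_gen0.
have [u [v [e [Lu Lv nz_e eU [eVV eVU]]]]] :=
  quadratic_pair_scalar odd_p char_K nz_v vX nz_z YYK XYYXK.
exists u, v, (val_gen e); split=> //; last split.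
- by apply: contraNneq nz_e => e0; rewrite -(val_genK e) e0 in_gen0.
- by rewrite -vJ // eU val_gen0.
- by rewrite -!vJ // eVV val_gen0.
by rewrite -!vJ // eVU val_genN !mulrSr !mulr0n !val_genD val_gen0.
Qed.

End IrreducibleQuadraticPair.

(** * Sections isomorphic to Qd(p) *)

Lemma Qd_free_morphim p (gT : finGroupType) (G H : {group gT})
    (f : {morphism H >-> Qd p}) :
  Qd_free p G -> H \subset G -> f @* H != [set: Qd p].
Proof.
move=> freeG sHG; apply/eqP=> fH; case: (freeG H ('ker f)%G sHG (ker_normal f)).
by rewrite -fH first_isog.
Qed.

Section NaturalModule.

Variables (p : nat) (gT : finGroupType) (G H : {group gT}).
Hypotheses (pr_p : prime p) (odd_p : odd p) (sHG : H \subset G).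
Variables (psi : {morphism [set: 'rV['F_p]_2] >-> gT}).
Variables (rH : mx_representation 'F_p H 2).
Hypotheses (inj_psi : 'injm psi) (sWG : psi @* setT \subset G).
Hypothesis psiJ : forall a, {in H, forall h, psi a ^ h = psi (a *m rH h)%R}.
Hypothesis det1 : {in H, forall h, (\det (rH h) = 1)%R}.
Hypothesis onto : forall A : 'M['F_p]_2, (\det A = 1)%R -> exists2 h, h \in H &
  rH h = A.

Let W := (psi @* setT)%G.
(** Preimage of the centre of SL_2(p). *)
Let D := [set h in H | (rH h == 1%:M) || (rH h == - 1%:M)]%R.

Let p_neq2 : p != 2. Proof. by apply: contraTneq odd_p => ->. Qed.

Let two_neq0 : (2%:R != 0 :> 'F_p)%R.
Proof.
by rewrite -(dvdn_pcharf (pchar_Fp pr_p)) dvdn_prime2.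
Qed.

Let opp1_neq1 : (- 1%:M != 1%:M :> 'M['F_p]_2)%R.
Proof.
apply: contra two_neq0 => /eqP/matrixP/(_ 0 0)%R; rewrite !mxE /= => e.
by rewrite -[2%:R%R]/(1 + 1)%R -[X in (X + _)%R]e addNr.
Qed.

Let DP h : h \in D -> h \in H /\ (rH h = 1%:M \/ rH h = - 1%:M)%R.
Proof. by case/setIdP=> Hh /pred2P. Qed.

Let group_set_D : group_set D.
Proof.
apply/group_setP; split=> [|g h /DP[Hg rg] /DP[Hh rh]].
  by rewrite inE group1 repr_mx1 eqxx.
rewrite inE groupM // repr_mxM //.
by case: rg rh => -> [] ->; rewrite ?mulNmx ?mulmxN ?mul1mx ?opprK eqxx ?orbT.
Qed.
Let D_group := Group group_set_D.

Let nDH : D_group <| H.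
Proof.
rewrite /normal; apply/andP; split; first by apply/subsetP=> h /DP[].
apply/subsetP=> h Hh; rewrite inE; apply/subsetP=> _ /imsetP[d /DP[Hd rd] ->].
rewrite inE groupJ // conjgE !repr_mxM ?groupM ?groupV // repr_mxV //.
have := repr_mx_unitr rH Hh => Uh.
by case: rd => ->; rewrite ?mulNmx ?mulmxN mul1mx mulVmx // eqxx ?orbT.
Qed.

(** Take a preimage of -1. Its 2'-part has odd order, so it cannot act as -1 and acts trivially;
    hence its 2-part acts as -1. Conjugating that into a Sylow 2-subgroup leaves the scalar matrix
    -1 unchanged. *)
Let exists_neg : exists s (S : {group gT}),
  [/\ 2.-Sylow(D_group) S, s \in S & rH s = - 1%:M]%R.
Proof.
have [|z Hz rz] := onto (A := - 1%:M)%R; first by rewrite det2E !mxE /=; ring.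
have Dz : z \in D_group by rewrite inE Hz rz eqxx orbT.
have Dzpi pi : z.`_pi \in D_group by rewrite groupX.
have rz2' : rH z.`_2^' = 1%:M%R.
  have [Hz2 [// | rz2]] := DP (Dzpi 2^').
  have odd_o : odd #[z.`_2^'] by rewrite odd_2'nat; apply: p_elt_constt.
  have := repr_mxX rH #[z.`_2^'] Hz2; rewrite expg_order repr_mx1 rz2.
  rewrite -[(- 1%:M)%R]/(-1)%R -signr_odd odd_o expr1 => e.
  by case/eqP: opp1_neq1.
have rz2 : rH z.`_2 = (- 1%:M)%R.
  have [[Hz2 _] [Hz2' _]] := (DP (Dzpi 2), DP (Dzpi 2^')).
  by rewrite -rz -[in RHS](consttC 2 z) repr_mxM // rz2' mulmx1.
have [S sylS] := Sylow_exists 2 D_group.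
have [|d Dd] := Sylow_Jsub sylS (_ : <[z.`_2]> \subset D_group) (p_elt_constt 2
  z).
  by rewrite cycle_subG.
rewrite -cycleJ cycle_subG => Sz; exists (z.`_2 ^ d), S; split=> //.
have [[Hz2 _] [Hd _]] := (DP (Dzpi 2), DP Dd).
rewrite conjgE !repr_mxM ?groupM ?groupV // rz2 mulNmx mul1mx mulmxN.
by rewrite -repr_mxM ?groupV // mulVg repr_mx1.
Qed.

(** [H] may meet [W] nontrivially, so it is replaced by the normalizer X of S in [H]: X still covers
    SL_2(p) but meets [W] trivially, and the semidirect product of [W] by X maps onto Qd(p). *)
Theorem natural_module_section : ~ Qd_free p G.
Proof.
move=> freeG; have [s [S [sylS Ss rs]]] := exists_neg.
have [sSD p2S _] := and3P sylS; have sSH := subset_trans sSD (normal_sub nDH).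
pose X := ('N_H(S))%G; have sXH : X \subset H := subsetIl _ _.
have Hs : s \in H := subsetP sSH _ Ss.
have Xs : s \in X by rewrite inE Hs (subsetP (normG S)).
(* By Frattini, h = d y with y in X and d acting as 1 or -1; a sign is absorbed by [s], which lies
   in X. *)
have ontoX (A : 'M['F_p]_2) : (\det A = 1)%R -> exists2 h, h \in X & rH h = A.
  case/onto=> h Hh <-; have : h \in D_group * 'N_H(S) by rewrite (Frattini_arg
    nDH sylS).
  case/mulsgP=> d y /DP[Hd rd] Xy ->; have Hy := subsetP sXH _ Xy.
  case: rd => rd; [exists y => // | exists (s * y); first by rewrite groupM].
    by rewrite repr_mxM // rd mul1mx.
  by rewrite !repr_mxM // rd rs.
have nWH : H \subset 'N(W).
  apply/subsetP=> h Hh; rewrite inE;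
    apply/subsetP=> _ /imsetP[_ /morphimP[a _ _ ->] ->].
  by rewrite psiJ // mem_morphim ?inE.
have nWX := subset_trans sXH nWH.
(* If psi(a) normalizes S, then psi(2a) = [s, psi(a)] lies in S, because [s] inverts psi(a). This
   2-element has order dividing the odd prime p, so 2a = 0 and a = 0. *)
have tiWX : W :&: X = 1.
  apply/trivgP/subsetP=> w /setIP[/morphimP[a _ _ ->] Xa]; rewrite inE.
  have sa : psi a ^ s = (psi a)^-1.
    by rewrite psiJ // rs mulmxN mulmx1 -[(- a)%R]/(a^-1)%g morphV ?inE.
  have Sg : psi (a *+ 2)%R \in S.
    have -> : psi (a *+ 2)%R = (psi a ^ s)^-1 * psi a.
      by rewrite sa invgK -morphM ?inE.
    rewrite -conjVg -commgEr commgEl groupMl ?groupV //.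
    by have [_ nSa] := setIP Xa; rewrite memJ_norm.
  have : #[psi (a *+ 2)%R] %| p.
    rewrite order_dvdn -morphX ?inE // FinRing.zmodXgE -scaler_nat pchar_Fp_0
      // scale0r.
    by rewrite -[0%R]/1%g morph1.
  case/primeP: (pr_p) => _ Dp /Dp/pred2P[/eqP|og]; last first.
    have := mem_p_elt p2S Sg; rewrite /p_elt og pnatE // => p2.
    by case/negP: p_neq2.
  rewrite order_eq1 !(morph_injm_eq1 inj_psi) ?inE // => /eqP.
  move=> a2; have : (2%:R *: a = 0)%R by rewrite scaler_nat a2.
  move/eqP; rewrite scaler_eq0 (negPf two_neq0) => /eqP->; exact: eqxx.
pose to := ('MR (SL2_natural p))%gact.
pose f1 w : Qd p := sdpair1 to (invm inj_psi w).
pose f2 h : Qd p := sdpair2 to (reprGLm rH h).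
have Sr h : h \in X -> reprGLm rH h \in SL2 p.
  move=> Xh; have Hh := subsetP sXH _ Xh.
  by rewrite inE -[GLval _]/(val _) val_reprGLm // det1.
have f1M : {in W &, {morph f1 : a b / a * b}}.
  by move=> a b Wa Wb; rewrite /f1 morphM // morphM ?inE.
have f2M : {in X &, {morph f2 : a b / a * b}}.
  by move=> a b Xa Xb; rewrite /f2 reprGLmM ?(subsetP sXH) // morphM ?Sr.
have actf : {in W & X, morph_act 'J 'J (Morphism f1M) (Morphism f2M)}.
  move=> _ h /morphimP[a _ _ ->] Xh; have Hh := subsetP sXH _ Xh.
  rewrite /= /f1 /f2 psiJ // !invmE ?inE // -(sdpair_act to (in_setT _) (Sr _
    Xh)).
  congr (sdpair1 to _); rewrite /= (mx_repr_actE _ _ (Sr _ Xh)) /=.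
  by rewrite -[GLval _]/(val _) val_reprGLm.
have defY : W ><| X = (W <*> X)%G := sdprodEY nWX tiWX.
have sYG : (W <*> X)%G \subset G by rewrite join_subG sWG (subset_trans sXH).
case/eqP: (Qd_free_morphim (sdprodm_morphism defY actf) freeG sYG).
rewrite /= im_sdprodm; apply/eqP; rewrite -subTset -(im_sdpair to).
apply: mulgSS; apply/subsetP=> _ /morphimP[a _ Da ->].
  by apply/morphimP; exists (psi a);
    rewrite ?mem_morphim ?inE //= /f1 invmE ?inE.
have [|h Xh rh] := ontoX (GLval a); first by move: Da; rewrite inE => /eqP.
apply/morphimP; exists h => //=; congr (sdpair2 to _); apply: val_inj.
by rewrite /= val_reprGLm ?(subsetP sXH) // rh.
Qed.

End NaturalModule.

(** Over a prime field, powers of [u] and [v] give all lower and all upper unitriangular matrices. A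
    matrix with nonzero (0, 1) entry is a product lower, upper, lower; otherwise a transvection on
    the right makes that entry nonzero. *)
Lemma transvections_onto_SL2 p (gT : finGroupType) (H : {group gT})
    (rH : mx_representation 'F_p H 2) (u v : gT) (s : 'F_p) :
  u \in H -> v \in H -> (s != 0)%R ->
  (rH u = mx2 1 0 s 1)%R -> (rH v = mx2 1 1 0 1)%R ->
  forall A : 'M['F_p]_2, (\det A = 1)%R -> exists2 h, h \in H & rH h = A.
Proof.
move=> Hu Hv nz_s ru rv.
have lower t : exists2 h, h \in H & (rH h = mx2 1 0 t 1)%R.
  have uX i : (rH (u ^+ i)%g = mx2 1 0 (i%:R * s) 1)%R.
    elim: i => [|i IHi]; first by rewrite repr_mx1 mul0r; apply: mx2P;
      rewrite !mxE.
    rewrite expgSr repr_mxM ?groupX // IHi ru mx2M; congr mx2; rewrite -?natr1;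
      ring.
  by exists (u ^+ (t / s)%R); rewrite ?groupX // uX natr_Zp divfK.
have upper t : exists2 h, h \in H & (rH h = mx2 1 t 0 1)%R.
  have vX i : (rH (v ^+ i)%g = mx2 1 i%:R 0 1)%R.
    elim: i => [|i IHi]; first by rewrite repr_mx1; apply: mx2P; rewrite !mxE.
    rewrite expgSr repr_mxM ?groupX // IHi rv mx2M; congr mx2; rewrite -?natr1;
      ring.
  by exists (v ^+ t); rewrite ?groupX // vX natr_Zp.
have bruhat (A : 'M['F_p]_2) : (A 0 1 != 0)%R -> (\det A = 1)%R ->
    exists2 h, h \in H & rH h = A.
  move=> nz_b detA.
  (* The two lower parameters are forced by the diagonal entries of the product; the (1, 0) entry
     then follows from the determinant. *)
  have [h1 Hh1 r1] := lower ((A 1 1 - 1) / A 0 1)%R.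
  have [h2 Hh2 r2] := upper (A 0%R 1%R).
  have [h3 Hh3 r3] := lower ((A 0 0 - 1) / A 0 1)%R.
  exists (h1 * h2 * h3); first by rewrite !groupM.
  rewrite !repr_mxM ?groupM // r1 r2 r3 !mx2M [RHS]mx2E.
  have eC : (A 1 0 = (A 0 0 * A 1 1 - 1) / A 0 1)%R.
    by apply: (mulIf nz_b); rewrite divfK // -detA det2E; ring.
  by rewrite eC; congr mx2; field.
move=> A detA; have [b0 | nz_b] := eqVneq (A 0 1)%R 0%R; last exact: bruhat.
have [v1 Hv1 rv1] := upper 1%R; have [v2 Hv2 rv2] := upper (- 1)%R.
have a_neq0 : (A 0 0 != 0)%R.
  apply/eqP=> a0; move/eqP: detA.
  by rewrite det2E a0 b0 !mul0r subr0 eq_sym oner_eq0.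
have [||h Hh rh] := bruhat (A *m mx2 1 1 0 1)%R.
- by rewrite mulmx2E b0 !mxE mulr1 mul0r addr0.
- by rewrite det_mulmx detA mul1r det2E !mxE /= !mul1r subr0.
exists (h * v2); first by rewrite groupM.
by rewrite repr_mxM // rh rv2; apply: mx2P; rewrite !mulmx2E !mxE /=; split;
  ring.
Qed.

(** * Quadratic pairs on an elementary abelian minimal normal subgroup *)

Section QuadraticSection.

Variables (p : nat) (gT : finGroupType) (G W : {group gT}) (x y : gT).
Let L := <<[set x; y]>>%G.
Hypotheses (pr_p : prime p) (odd_p : odd p).
Hypotheses (abelW : p.-abelem W) (minW : minnormal W L).
Hypotheses (sWG : W \subset G) (sLG : L \subset G).
Hypotheses (Wxx : {in W, forall w, [~ w, x, x] = 1}).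
Hypotheses (Wyy : {in W, forall w, [~ w, y, y] = 1}).

(** [W] is an irreducible F_p-module for [L] on which [w, g] reads w (g - 1). As -4 is a nonzero
    element of F_p, the pair u, v acts by transvections on the F_p-span of e and e (v - 1), and so
    induces all of SL_2(p) there. *)
Theorem quadratic_pair_not_Qd_free : x \notin 'C(W) -> ~ Qd_free p G.
Proof.
move=> ncWx.
have [ntW nWL] : W :!=: 1 /\ L \subset 'N(W) by case/mingroupp/andP: minW.
pose rL := abelem_repr abelW ntW nWL.
have irrL : mx_irreducible rL by apply/abelem_mx_irrP.
have Lx : x \in L by rewrite mem_gen // !inE eqxx.
have Ly : y \in L by rewrite mem_gen // !inE eqxx orbT.
pose rV := rVabelem abelW ntW.
have cWW : abelian W by case/and3P: abelW.
have rVB w g : g \in L -> rV (w *m (rL g - 1%:M))%R = [~ rV w, g].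
  move=> Lg; rewrite mulmxBr mulmx1 /rV rVabelemD rVabelemN rVabelemJ //.
  rewrite commgEl; apply: (centsP cWW);
    rewrite ?groupV ?memJ_norm ?mem_rVabelem //.
  exact: (subsetP nWL).
have quad g : g \in L -> {in W, forall w, [~ w, g, g] = 1} ->
    ((rL g - 1%:M) *m (rL g - 1%:M) = 0)%R.
  move=> Lg Wgg; apply/row_matrixP=> i; rewrite row0 rowE mulmxA.
  apply: (rVabelem_inj abelW ntW); rewrite -/rV !rVB // Wgg ?mem_rVabelem //.
  by rewrite /rV rVabelem0.
have char_p : (p%:R = 0 :> 'F_p)%R by apply: pchar_Fp_0.
have ntx : rL x != 1%:M%R.
  apply: contra ncWx => /eqP rx; apply/centP=> w Ww; apply/esym/commgP.
  have := rVB (abelem_rV abelW ntW w) x Lx; rewrite /rV abelem_rV_K // => <-.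
  by rewrite rx subrr mulmx0 rVabelem0.
have [u [v [e [Lu Lv nz_e eU [eVV eVU]]]]] :=
  irreducible_quadratic_pair odd_p char_p irrL (quad x Lx Wxx) (quad y Ly Wyy)
    ntx.
pose H := <<[set u; v]>>%G.
have sHL : H \subset L by rewrite gen_subG subUset !sub1set Lu.
have Hu : u \in H by rewrite mem_gen // !inE eqxx.
have Hv : v \in H by rewrite mem_gen // !inE eqxx orbT.
have nz_4 : (- 4%:R != 0 :> 'F_p)%R.
  rewrite oppr_eq0 (natrM _ 2 2) mulf_eq0 orbb -(dvdn_pcharf (pchar_Fp pr_p))
    dvdn_prime2 //.
  by apply: contraTneq odd_p => ->.
pose rH := subg_repr rL sHL.
have eVU' : (e *m (rH v - 1%:M) *m (rH u - 1%:M) = - 4%:R *: e)%R.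
  by rewrite /= eVU scaleNr scaler_nat.
have [rB [B [freeB rBE rBu rBv det1]]] := natural_basis (rL := rH) nz_e nz_4 eU
  eVU' eVV.
pose psi (a : 'rV['F_p]_2) := rV (a *m B)%R.
have psiM : {in setT &, {morph psi : a b / a * b}}.
  by move=> a b _ _; rewrite /psi -rVabelemD -mulmxDl.
have inj_psi : 'injm (Morphism psiM).
  apply/injmP=> a b _ _ /= eab; apply: (row_free_inj freeB).
  exact: (rVabelem_inj abelW ntW).
apply: (natural_module_section (H := H) pr_p odd_p _ inj_psi _ _ det1).
- exact: subset_trans sLG.
- by apply: subset_trans sWG; apply/subsetP=> _ /morphimP[a _ _ ->];
  apply: mem_rVabelem.
- move=> a h Hh; have Lh := subsetP sHL _ Hh.
  by rewrite /= /psi -mulmxA rBE // mulmxA /rV rVabelemJ.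
exact: transvections_onto_SL2 Hu Hv nz_4 rBu rBv.
Qed.

End QuadraticSection.

(** * Quadratic action on p-groups *)

Lemma Qd_free_sub p (gT : finGroupType) (G J : {group gT}) :
  J \subset G -> Qd_free p G -> Qd_free p J.
Proof. by move=> sJG freeG H K sHJ; apply: freeG (subset_trans sHJ sJG). Qed.

Lemma Qd_free_quotient p (gT : finGroupType) (G U : {group gT}) :
  U <| G -> Qd_free p G -> Qd_free p (G / U).
Proof.
move=> nUG freeG Hb Kb sHG nKH.
case: (inv_quotientS nUG sHG) => H defH sUH sHG0.
have nUH : U <| H := normalS sUH sHG0 nUG.
rewrite defH in nKH *; case: (inv_quotientN nUH nKH) => K defK sUK nKH0.
rewrite defK => isoQ; apply: (freeG H K sHG0 nKH0).
by apply: isog_trans isoQ; rewrite isog_sym third_isog.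
Qed.

Section QuadraticAction.

Variables (p : nat) (gT : finGroupType) (G P : {group gT}).
Hypotheses (pr_p : prime p) (odd_p : odd p) (freeG : Qd_free p G).
Hypotheses (nPG : P <| G) (pP : p.-group P).

Let quadratic x := {in P, forall a, [~ a, x, x] = 1}.

(** P acts trivially on V / U, which is therefore already minimal normal under the images of [x] and
    [y], and the elementary abelian case applies in J / U. Giving [J] by an equation lets [x] and
    [y] exchange roles. *)
Lemma quadratic_pair_chief_factor (x y : gT) (J U V : {group gT}) :
    x \in G -> y \in G -> quadratic x -> quadratic y ->
    J :=: <<[set x; y]>> <*> P -> V \subset P -> chief_factor J U V ->
  x \in 'C(V / U | 'Q).
Proof.
move=> Gx Gy qx qy defJ sVP chV; apply/negPn/negP=> ncx.
have minV := chief_factor_minnormal chV.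
have [/maxgroupp/andP[/andP[sUV _] nUJ] nVJ] := andP chV.
have sLJ : <<[set x; y]>> \subset J by rewrite defJ joing_subl.
have sPJ : P \subset J by rewrite defJ joing_subr.
have nsUJ : U <| J by rewrite /normal (subset_trans sUV (normal_sub nVJ)).
have sJG : J \subset G.
  by rewrite defJ join_subG gen_subG subUset !sub1set Gx Gy normal_sub.
have nPJ : P <| J := normalS sPJ sJG nPG.
have nUL := subset_trans sLJ nUJ; have nUP := subset_trans sPJ nUJ.
have Lx : x \in <<[set x; y]>> by rewrite mem_gen // !inE eqxx.
have Ly : y \in <<[set x; y]>> by rewrite mem_gen // !inE eqxx orbT.
have [nUx nUy] := (subsetP nUL x Lx, subsetP nUL y Ly).
have pVU : p.-group (V / U) := quotient_pgroup _ (pgroupS sVP pP).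
have [nVUJ ntVU] : J / U \subset 'N(V / U) /\ V / U != 1.
  by case/mingroupp/andP: minV.
have abelV : p.-abelem (V / U).
  have [_ _ abV] := minnormal_solvable minV (subxx _) (pgroup_sol pVU).
  by rewrite -is_abelem_pgroup.
(* A nontrivial normal subgroup of the p-group P / U meets its centre; the intersection is
   J-invariant, so it is all of V / U. *)
have cVP : V / U \subset 'Z(P / U).
  have [_ minV'] := mingroupP minV;
    rewrite -(minV' (V / U :&: 'Z(P / U))%G) ?subsetIl //.
    by rewrite subsetIr.
  rewrite meet_center_nil ?(pgroup_nil (quotient_pgroup _ pP)) //=.
    rewrite normsI // (char_norm_trans (center_char _)) //.
    by rewrite quotient_norms // normal_norm.
  by rewrite /normal quotientS // (subset_trans (quotientS _ sPJ)).
have defLU : <<[set x; y]>> / U = <<[set coset U x; coset U y]>>.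
  rewrite quotient_gen; last by rewrite subUset !sub1set nUx.
  by rewrite /quotient morphimU !morphim_set1.
have minL : minnormal (V / U) <<[set coset U x; coset U y]>>.
  rewrite -defLU; apply/mingroupP; split=> [|M /andP[ntM nML] sMV].
    by rewrite ntVU (subset_trans (quotientS _ sLJ)).
  have [_ minV'] := mingroupP minV; apply: minV' => //; rewrite ntM /=.
  rewrite defJ quotientY // join_subG nML cents_norm //.
  apply: subset_trans (centS sMV); rewrite centsC.
  exact: subset_trans cVP (subsetIr _ _).
have quadU z : z \in 'N(U) -> quadratic z ->
    {in V / U, forall w, [~ w, coset U z, coset U z] = 1}.
  move=> nUz qz _ /morphimP[a nUa Va ->].
  by rewrite -!morphR ?groupR // qz ?morph1 // (subsetP sVP).
apply: (quadratic_pair_not_Qd_free pr_p odd_p abelV minL _ _ (quadU x nUx qx)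
  (quadU y nUy qy)).
- exact: (quotientS U (normal_sub nVJ)).
- by rewrite /= -defLU quotientS.
- by apply: contra ncx; rewrite astabQ => cx; apply/morphpreP.
exact: Qd_free_quotient nsUJ (Qd_free_sub sJG freeG).
Qed.

(** By coprimeness, fixed points of [A] on V / U lift to V, so centralization climbs a chief series
    from 1 to [P]. *)
Lemma stable_chief_series_cent (J A : {group gT}) :
    P <| J -> A \subset J -> coprime #|P| #|A| ->
    (forall U V : {group gT}, V \subset P -> chief_factor J U V -> A \subset
      'C(V / U | 'Q)) ->
  A \subset 'C(P).
Proof.
move=> nPJ sAJ coPA stabA; have [s chs eP] := chief_series_exists nPJ.
suffices cA : last 1%G s \subset P -> A \subset 'C(last 1%G s) by rewrite -eP
  cA ?eP.
elim/last_ind: s chs {eP} => [|s V IHs]; first by rewrite /= cents1.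
rewrite rcons_path last_rcons => /andP[/IHs cA chV] sVP.
set U := last 1%G s in cA chV.
have [/maxgroupp/andP[/andP[sUV _] nUJ] nVJ] := andP chV.
have nUA := subset_trans sAJ nUJ;
  have nVA := subset_trans sAJ (normal_norm nVJ).
have pU : p.-group U := pgroupS (subset_trans sUV sVP) pP.
have cAU := cA (subset_trans sUV sVP).
have coUA : coprime #|U| #|A|.
  by apply: coprimeSg coPA; apply: subset_trans sUV sVP.
have := coprime_norm_quotient_cent nVA nUA coUA (pgroup_sol pU).
have cAVU : A / U \subset 'C(V / U).
  by rewrite sub_quotient_pre // -astabQ stabA.
rewrite ['C_(V / U)(_)](setIidPl _) 1?centsC // => eq_quo.
have sUC : U \subset 'C_V(A) by rewrite subsetI sUV centsC.
have nUV := subset_trans (normal_sub nVJ) nUJ.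
have : V \subset 'C_V(A) by rewrite -(quotientSGK nUV sUC) eq_quo.
by rewrite subsetI subxx centsC.
Qed.

(** An element of prime order q, q different from p, would be the image of a p'-element of L. The
    latter is trivial on every chief factor of LP below [P], so by coprime action it centralizes [P]
    and its image is trivial. *)
Lemma quadratic_pair_pgroup (x y : gT) :
    x \in G -> y \in G -> quadratic x -> quadratic y ->
  p.-group (<<[set x; y]>> / 'C_G(P)).
Proof.
move=> Gx Gy qx qy; set L := <<_>>; set C := 'C_G(P).
have sLG : L \subset G by rewrite gen_subG subUset !sub1set Gx.
have nCG : G \subset 'N(C) by rewrite normsI ?normG // norms_cent ?normal_norm.
pose J := (L <*> P)%G.
have sJG : J \subset G by rewrite join_subG sLG normal_sub.
have nPJ : P <| J := normalS (joing_subr _ _) sJG nPG.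
have stabL (U V : {group gT}) : V \subset P -> chief_factor J U V -> L \subset
  'C(V / U | 'Q).
  move=> sVP chV; rewrite gen_subG subUset !sub1set.
  rewrite (quadratic_pair_chief_factor Gx Gy qx qy _ sVP chV) //.
  by apply: quadratic_pair_chief_factor Gy Gx qy qx _ sVP chV; rewrite setUC.
apply/pgroupP=> q pr_q /(Cauchy pr_q)[_ /morphimP[h Nh Lh ->] oh].
apply/idPn=> p'q; have: #[coset C h] = 1%N.
  have p'h : p^'.-elt (coset C h) by rewrite /p_elt oh pnatE.
  rewrite -(constt_p_elt p'h) -morph_constt //.
  have Lk : h.`_p^' \in L by rewrite groupX.
  have : <[h.`_p^']> \subset 'C(P).
    apply: (stable_chief_series_cent nPJ).
    - by rewrite cycle_subG (subsetP (joing_subl _ _)).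
    - exact: pnat_coprime pP (p_elt_constt _ _).
    by move=> U V sVP chV; rewrite cycle_subG (subsetP (stabL U V sVP chV)).
  by rewrite cycle_subG /= => Ck; rewrite coset_id ?order1 // inE (subsetP sLG).
by move=> o1; rewrite o1 in oh; rewrite -oh in pr_q.
Qed.

Lemma quadratic_pcore_mod (x : gT) :
  x \in G -> quadratic x -> x \in pcore_mod G p 'C_G(P).
Proof.
move=> Gx qx; set C := 'C_G(P).
have nCG : G \subset 'N(C) by rewrite normsI ?normG // norms_cent ?normal_norm.
have nCx := subsetP nCG x Gx; apply/morphpreP; split=> //.
apply: Baer_Suzuki; first exact: mem_quotient.
move=> _ /morphimP[g nCg Gg ->]; rewrite -morphJ //.
have Gxg : x ^ g \in G by rewrite groupJ.
have qxg : quadratic (x ^ g).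
  move=> a Pa; rewrite -(conjgKV g a) -!conjRg qx ?conj1g //.
  by rewrite memJ_norm ?groupV // (subsetP (normal_norm nPG)).
have := quadratic_pair_pgroup Gx Gxg qx qxg.
rewrite quotient_gen; last by rewrite subUset !sub1set nCx (subsetP nCG).
by rewrite /quotient morphimU !morphim_set1 // (subsetP nCG).
Qed.

(** Write the preimage as R = C S with S a Sylow p-subgroup of R. As C is trivial on V / U, the
    fixed points of R there are those of S, hence nontrivial since S is a p-group; they are
    G-invariant, so they fill V / U. *)
Lemma pcore_mod_cent_chief_factor (U V : {group gT}) :
  V \subset P -> chief_factor G U V -> pcore_mod G p 'C_G(P) \subset 'C(V / U |
    'Q).
Proof.
move=> sVP chV; set C := 'C_G(P)%G.
have minV := chief_factor_minnormal chV.
have [/maxgroupp/andP[/andP[sUV _] nUG] nVG] := andP chV.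
have nsUG : U <| G by rewrite /normal (subset_trans sUV (normal_sub nVG)).
have nCG : G \subset 'N(C) by rewrite normsI ?normG // norms_cent ?normal_norm.
have nsCG : C <| G by rewrite /normal subsetIl.
have [nVUG ntVU] : G / U \subset 'N(V / U) /\ V / U != 1.
  by case/mingroupp/andP: minV.
have pVU : p.-group (V / U) := quotient_pgroup _ (pgroupS sVP pP).
case: (inv_quotientN nsCG (pcore_normal p (G / C))) => R defR sCR nRG.
have [sRG nRGn] := andP nRG.
have -> : pcore_mod G p C = R by rewrite /pcore_mod defR quotientGK // (normalS
  _ sRG).
have pRC : p.-group (R / C) by rewrite -defR pcore_pgroup.
have [S sylS] := Sylow_exists p R; have [sSR pS _] := and3P sylS.
have nCR := subset_trans sRG nCG.
have sRCS : R \subset C * S.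
  by rewrite -quotientSK // (pHall_id (quotient_pHall (subset_trans sSR nCR)
    sylS) pRC).
have nUR := subset_trans sRG nUG; have nUS := subset_trans sSR nUR.
have nUC := subset_trans sCR nUR.
have nVS : S / U \subset 'N(V / U) by apply: subset_trans (quotientS _
  (subset_trans sSR sRG)) nVUG.
have pT : p.-group ((V / U) <*> (S / U)).
  by rewrite norm_joinEr // pgroupM pVU quotient_pgroup.
have nVT : V / U <| (V / U) <*> (S / U) by rewrite /normal joing_subl join_subG
  normG.
have cCV : C / U \subset 'C(V / U).
  by rewrite quotient_cents // (subset_trans (subsetIr _ _)) // centS.
have [_ minV'] := mingroupP minV.
have eN : V / U :&: 'C(R / U) = V / U.
  apply: minV'; rewrite ?subsetIl //= normsI ?norms_cent ?quotient_norms
    ?(normal_norm nVG) // andbT.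
  apply: contraNneq (meet_center_nil (pgroup_nil pT) nVT ntVU) => c1.
  rewrite -subG1 -c1 subsetI subsetIl /=.
  apply: subset_trans (centS (quotientS U sRCS));
    rewrite quotientMl // centM subsetI.
  rewrite subIset 1?centsC ?cCV //=.
  rewrite centsC; apply: (subset_trans (subsetIr _ _));
    apply: (subset_trans (subsetIr _ _)).
  by rewrite centS // joing_subr.
by rewrite astabQ -sub_quotient_pre // centsC -eN subsetIr.
Qed.

End QuadraticAction.

Theorem theoremB (p : nat) (gT : finGroupType) (G P : {group gT}) (x : gT)
    (pr_p : prime p) (odd_p : odd p) (freeG : Qd_free p G)
    (nPG : P <| G) (pP : p.-group P) (Gx : x \in G)
    (cPxx : [~: P, [set x], [set x]] = 1) :
  (forall U V : {group gT},
     V \subset P -> chief_factor G U V -> x \in 'C(V / U | 'Q)) /\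
  x \in pcore_mod G p 'C_G(P).
Proof.
(* The elementwise form passes to conjugates and quotients directly. *)
have qx : {in P, forall a, [~ a, x, x] = 1}.
  move=> a Pa; apply/set1gP; rewrite -cPxx.
  by apply: mem_commg; [apply: mem_commg | ]; rewrite ?set11.
have Ox := quadratic_pcore_mod pr_p odd_p freeG nPG pP Gx qx.
split=> // U V sVP chV.
exact: (subsetP (pcore_mod_cent_chief_factor nPG pP sVP chV)).
Qed.
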